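(* For $\mathbf{x} = \{x_0, x_1, \dots, x_{n-1}\}$ with $n$ odd, let $\Phi$ be the endomorphism of the free group $F(\mathbf{x})$ defined by $x_i \mapsto x_i x_{i+1}$ for $0 \le i < n$ (subscripts modulo $n$). For $a \ge 0$ let $\hat{G}_a$ be the group presented by $\langle \mathbf{x} : \Phi^a(\mathbf{x}) \rangle$. Then for every $a > 0$ the group $\hat{G}_a$ is cyclic of order $2^a$, and its normal subgroups $N_k = \langle \Phi^{a-k}(\mathbf{x}) \rangle \cong \hat{G}_k$, $0 \le k \le a$, form a composition series with $N_k / N_{k-1} \cong \mathbb{Z}_2$ for $0 < k \le a$.
   Context: $\Phi^a(\mathbf{x}) = \{\Phi^a(x_i) : 0 \le i < n\}$, with $\Phi^0$ the identity. $N_k$ denotes the subgroup of $\hat{G}_a$ generated by the images of the elements $\Phi^{a-k}(x_i)$, $0 \le i < n$. *)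

(* Defs.v *)
From HB Require Import structures.
From mathcomp Require Import all_boot generic_quotient zmodp.
From mathcomp Require Import boolp classical_sets cardinality.

Set Implicit Arguments.
Unset Strict Implicit.
Unset Printing Implicit Defensive.

Local Open Scope quotient_scope.
Local Open Scope card_scope.
Local Open Scope classical_set_scope.
Local Open Scope group_scope.

(* Subgroups of a groupType are elements of the library structure groupClosed:
   boolean predicates closed under 1, product and inverse. *)

Section Subgroups.
Variable G : groupType.
Implicit Types (S : set G) (H K : groupClosed G).

Definition generated_pred S : {pred G} :=
  fun x => `[< forall H, (forall s, S s -> s \in H) -> x \in H >].

Lemma generated_predP S x :
  reflect (forall H, (forall s, S s -> s \in H) -> x \in H)
          (x \in generated_pred S).
Proof. exact: asboolP. Qed.

Lemma generated_group1 S : 1 \in generated_pred S.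
Proof. by apply/generated_predP => H _; exact: gpred1. Qed.

Lemma generated_groupM S :
  {in generated_pred S &, forall x y, x * y \in generated_pred S}.
Proof.
move=> x y /generated_predP xS /generated_predP yS.
by apply/generated_predP => H SH; apply: gpredM; [exact: xS | exact: yS].
Qed.

Lemma generated_groupV S :
  {in generated_pred S, forall x, x^-1 \in generated_pred S}.
Proof.
move=> x /generated_predP xS.
by apply/generated_predP => H SH; apply: gpredVr; exact: xS.
Qed.

HB.instance Definition _ S :=
  isMulClosed.Build G (generated_pred S) (@generated_groupM S).
HB.instance Definition _ S :=
  isMul1Closed.Build G (generated_pred S) (generated_group1 S).
HB.instance Definition _ S :=
  isInvClosed.Build G (generated_pred S) (@generated_groupV S).

Definition generated S : groupClosed G := generated_pred S.

Definition is_normal H : Prop := forall x y, x \in H -> x ^ y \in H.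

Definition normal_closure S : groupClosed G :=
  generated [set z | exists s y, S s /\ z = s ^ y].

Definition is_trivial H : Prop := forall x, x \in H <-> x = 1.

Definition is_full H : Prop := forall x, x \in H.

Definition is_cyclic : Prop := exists g, is_full (generated [set g]).

Definition is_simple : Prop :=
  (exists x : G, x <> 1) /\
  forall H, is_normal H -> is_trivial H \/ is_full H.

Record subgroup_type H := SubgroupElt {
  subgroup_val : G;
  subgroup_valP : subgroup_val \in H }.

End Subgroups.

Arguments is_cyclic : clear implicits.
Arguments is_simple : clear implicits.

HB.instance Definition _ (G : groupType) (H : groupClosed G) :=
  [isSub for @subgroup_val G H].
HB.instance Definition _ (G : groupType) (H : groupClosed G) :=
  [Choice of subgroup_type H by <:].

Lemma subgroup_group_closed (G : groupType) (H : groupClosed G) :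
  group_closed (mem H).
Proof.
split; first exact: gpred1.
by move=> x y xH yH; apply: gpredM => //; exact: gpredVr.
Qed.

HB.instance Definition _ (G : groupType) (H : groupClosed G) :=
  SubChoice_isSubGroup.Build G (mem H) (subgroup_type H)
    (subgroup_group_closed H).

Section SubgroupOfSubgroup.
Variables (G : groupType) (K H : groupClosed G).

Definition restrict_pred : {pred subgroup_type K} := fun x => val x \in H.

Lemma restrict_group1 : 1 \in restrict_pred.
Proof. exact: gpred1. Qed.

Lemma restrict_groupM :
  {in restrict_pred &, forall x y, x * y \in restrict_pred}.
Proof. by move=> x y xH yH; exact: (gpredM _ _ xH yH). Qed.

Lemma restrict_groupV : {in restrict_pred, forall x, x^-1 \in restrict_pred}.
Proof. by move=> x xH; exact: (gpredVr _ xH). Qed.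

HB.instance Definition _ :=
  isMulClosed.Build (subgroup_type K) restrict_pred restrict_groupM.
HB.instance Definition _ :=
  isMul1Closed.Build (subgroup_type K) restrict_pred restrict_group1.
HB.instance Definition _ :=
  isInvClosed.Build (subgroup_type K) restrict_pred restrict_groupV.

(* H :&: K, seen as a subgroup of the group K. *)
Definition restrict : groupClosed (subgroup_type K) := restrict_pred.

End SubgroupOfSubgroup.

Section QuotientGroup.
Variables (G : groupType) (N : groupClosed G).

Definition coset_rel : rel G := fun x y => x^-1 * y \in N.

Lemma coset_rel_refl : reflexive coset_rel.
Proof. by move=> x; rewrite /coset_rel mulVg gpred1. Qed.

Lemma coset_rel_sym : symmetric coset_rel.
Proof. by move=> x y; rewrite /coset_rel -gpredV invgM invgK. Qed.

Lemma coset_rel_trans : transitive coset_rel.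
Proof.
move=> y x z xy yz; rewrite /coset_rel.
by have := gpredM _ _ xy yz; rewrite mulgA mulgK.
Qed.

Canonical coset_equiv :=
  EquivRel coset_rel coset_rel_refl coset_rel_sym coset_rel_trans.

Hypothesis nN : is_normal N.

Definition quotient_group of is_normal N := {eq_quot coset_equiv}.

Local Notation Q := (quotient_group nN).

HB.instance Definition _ := Choice.on Q.
HB.instance Definition _ := EqQuotient.on Q.

Definition quotient_map : G -> Q := \pi_Q.

Definition quotient_mul (u v : Q) : Q := quotient_map (repr u * repr v).
Definition quotient_one : Q := quotient_map 1.
Definition quotient_inv (u : Q) : Q := quotient_map (repr u)^-1.

Lemma quotient_mapP x y :
  reflect (quotient_map x = quotient_map y) (x^-1 * y \in N).
Proof. by apply: (iffP idP) => [xy|/eqmodP//]; apply/eqmodP. Qed.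

Lemma quotient_reprK u : quotient_map (repr u) = u.
Proof. exact: reprK. Qed.

Lemma quotient_mulE x y :
  quotient_mul (quotient_map x) (quotient_map y) = quotient_map (x * y).
Proof.
apply/quotient_mapP; set a := repr _; set b := repr _.
have /quotient_mapP ax : quotient_map a = quotient_map x by exact: reprK.
have /quotient_mapP yb : quotient_map b = quotient_map y by exact: reprK.
have -> : (a * b)^-1 * (x * y) = (a^-1 * x) ^ b * (b^-1 * y).
  by rewrite conjgE invgM !mulgA mulgK.
by apply: gpredM => //; exact: nN.
Qed.

Lemma quotient_invE x : quotient_inv (quotient_map x) = quotient_map x^-1.
Proof.
apply/quotient_mapP; set a := repr _.
have /quotient_mapP ax : quotient_map a = quotient_map x by exact: reprK.
have -> : a^-1^-1 * x^-1 = ((a^-1 * x) ^ a^-1)^-1.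
  by rewrite conjgE invgK !mulgA mulgV mul1g invgM !invgK.
by apply: gpredVr; exact: nN.
Qed.

Lemma quotient_mulA : associative quotient_mul.
Proof.
move=> u v w; rewrite -(quotient_reprK u) -(quotient_reprK v).
by rewrite -(quotient_reprK w) !quotient_mulE mulgA.
Qed.

Lemma quotient_mul1 : left_id quotient_one quotient_mul.
Proof. by move=> u; rewrite -(quotient_reprK u) quotient_mulE mul1g. Qed.

Lemma quotient_mulr1 : right_id quotient_one quotient_mul.
Proof. by move=> u; rewrite -(quotient_reprK u) quotient_mulE mulg1. Qed.

Lemma quotient_mulV : left_inverse quotient_one quotient_inv quotient_mul.
Proof.
by move=> u; rewrite -(quotient_reprK u) quotient_invE quotient_mulE mulVg.
Qed.

Lemma quotient_mulrV : right_inverse quotient_one quotient_inv quotient_mul.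
Proof.
by move=> u; rewrite -(quotient_reprK u) quotient_invE quotient_mulE mulgV.
Qed.

HB.instance Definition _ := isGroup.Build Q quotient_mulA quotient_mul1
  quotient_mulr1 quotient_mulV quotient_mulrV.

End QuotientGroup.

Section FreeGroup.
Variable T : choiceType.

(* (false, x) stands for the letter x and (true, x) for its inverse. *)
Definition word := seq (bool * T).

Inductive word_eq : word -> word -> Prop :=
| word_eq_cancel u v b x :
    word_eq (u ++ [:: (b, x), (~~ b, x) & v]) (u ++ v)
| word_eq_refl u : word_eq u u
| word_eq_sym u v : word_eq u v -> word_eq v u
| word_eq_trans u v w : word_eq u v -> word_eq v w -> word_eq u w.

Definition word_rel : rel word := fun u v => `[< word_eq u v >].

Lemma word_rel_refl : reflexive word_rel.
Proof. by move=> u; apply/asboolP; exact: word_eq_refl. Qed.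

Lemma word_rel_sym : symmetric word_rel.
Proof. by move=> u v; apply/asboolP/asboolP; exact: word_eq_sym. Qed.

Lemma word_rel_trans : transitive word_rel.
Proof.
move=> v u w /asboolP uv /asboolP vw.
by apply/asboolP; exact: word_eq_trans vw.
Qed.

Canonical word_equiv :=
  EquivRel word_rel word_rel_refl word_rel_sym word_rel_trans.

Definition free_group := {eq_quot word_equiv}.

HB.instance Definition _ := Choice.on free_group.
HB.instance Definition _ := EqQuotient.on free_group.

Definition word_class : word -> free_group := \pi_free_group.

Lemma word_classP u v : word_class u = word_class v <-> word_eq u v.
Proof.
split=> [/eqmodP/asboolP//|uv].
by apply/eqmodP/asboolP.
Qed.

Definition word_inv (u : word) : word := rev [seq (~~ p.1, p.2) | p <- u].

Lemma word_eq_cat u u' v v' :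
  word_eq u u' -> word_eq v v' -> word_eq (u ++ v) (u' ++ v').
Proof.
move=> uu' vv'; apply: (@word_eq_trans _ (u' ++ v)).
  elim: uu' => [w1 w2 b x|w|w1 w2 _|w1 w2 w3 _ IH1 _ IH2].
  - by rewrite -!catA /=; exact: word_eq_cancel.
  - exact: word_eq_refl.
  - exact: word_eq_sym.
  - exact: word_eq_trans IH2.
elim: vv' => [w1 w2 b x|w|w1 w2 _|w1 w2 w3 _ IH1 _ IH2].
- by rewrite !catA; exact: word_eq_cancel.
- exact: word_eq_refl.
- exact: word_eq_sym.
- exact: word_eq_trans IH2.
Qed.

Lemma word_inv_cat u v : word_inv (u ++ v) = word_inv v ++ word_inv u.
Proof. by rewrite /word_inv map_cat rev_cat. Qed.

Lemma word_invK : involutive word_inv.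
Proof.
move=> u; rewrite /word_inv map_rev revK -map_comp map_id_in //.
by case=> b x _ /=; rewrite negbK.
Qed.

Lemma word_eq_inv u v : word_eq u v -> word_eq (word_inv u) (word_inv v).
Proof.
elim=> [w1 w2 b x|w|w1 w2 _|w1 w2 w3 _ IH1 _ IH2].
- rewrite !word_inv_cat (word_inv_cat [:: _; _] w2) -catA /word_inv /= negbK.
  exact: word_eq_cancel.
- exact: word_eq_refl.
- exact: word_eq_sym.
- exact: word_eq_trans IH2.
Qed.

Lemma word_eq_catV u : word_eq (u ++ word_inv u) [::].
Proof.
elim: u => [|[b x] u IH]; first exact: word_eq_refl.
rewrite -cat1s word_inv_cat -catA (catA u).
apply: (@word_eq_trans _ ([:: (b, x)] ++ [::] ++ word_inv [:: (b, x)])).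
  apply: word_eq_cat (word_eq_refl _) _.
  exact: word_eq_cat IH (word_eq_refl _).
exact: (word_eq_cancel [::] [::]).
Qed.

Definition free_mul (u v : free_group) : free_group :=
  word_class (repr u ++ repr v).
Definition free_one : free_group := word_class [::].
Definition free_inv (u : free_group) : free_group :=
  word_class (word_inv (repr u)).

Lemma word_class_repr u : word_class (repr u) = u.
Proof. exact: reprK. Qed.

Lemma free_mulE u v :
  free_mul (word_class u) (word_class v) = word_class (u ++ v).
Proof.
by apply/word_classP; apply: word_eq_cat; apply/word_classP;
  exact: word_class_repr.
Qed.

Lemma free_invE u : free_inv (word_class u) = word_class (word_inv u).
Proof.
by apply/word_classP; apply: word_eq_inv; apply/word_classP;
  exact: word_class_repr.
Qed.

Lemma free_mulA : associative free_mul.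
Proof.
move=> u v w; rewrite -(word_class_repr u) -(word_class_repr v).
by rewrite -(word_class_repr w) !free_mulE catA.
Qed.

Lemma free_mul1 : left_id free_one free_mul.
Proof. by move=> u; rewrite -(word_class_repr u) free_mulE. Qed.

Lemma free_mulr1 : right_id free_one free_mul.
Proof. by move=> u; rewrite -(word_class_repr u) free_mulE cats0. Qed.

Lemma free_mulrV : right_inverse free_one free_inv free_mul.
Proof.
move=> u; rewrite -(word_class_repr u) free_invE free_mulE.
by apply/word_classP; exact: word_eq_catV.
Qed.

Lemma free_mulV : left_inverse free_one free_inv free_mul.
Proof.
move=> u; rewrite -(word_class_repr u) free_invE free_mulE.
apply/word_classP; rewrite -{2}[repr u]word_invK.
exact: word_eq_catV.
Qed.

HB.instance Definition _ := isGroup.Build free_group free_mulA free_mul1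
  free_mulr1 free_mulV free_mulrV.

Definition free_gen (x : T) : free_group := word_class [:: (false, x)].

Definition word_eval (G : groupType) (f : T -> G) (u : word) : G :=
  \prod_(p <- u) (if p.1 then (f p.2)^-1 else f p.2).

(* The homomorphism free_group T -> G with x |-> f x on generators; see
   free_extM, free_ext_gen and free_ext_uniq. *)
Definition free_ext (G : groupType) (f : T -> G) (u : free_group) : G :=
  word_eval f (repr u).

Section Extension.
Variables (G : groupType) (f : T -> G).

Lemma word_eval_cat u v : word_eval f (u ++ v) = word_eval f u * word_eval f v.
Proof. exact: big_cat. Qed.

Lemma word_eval_eq u v : word_eq u v -> word_eval f u = word_eval f v.
Proof.
elim=> [w1 w2 b x|//|w1 w2 _ ->//|w1 w2 w3 _ -> _ ->//].
rewrite !word_eval_cat /word_eval !big_cons /= !mulgA; congr (_ * _).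
by case: b => /=; rewrite ?mulgK ?mulgVK.
Qed.

Lemma free_extE u : free_ext f (word_class u) = word_eval f u.
Proof. by apply/word_eval_eq/word_classP; exact: word_class_repr. Qed.

Lemma free_ext_gen x : free_ext f (free_gen x) = f x.
Proof. by rewrite free_extE /word_eval big_seq1. Qed.

Lemma free_extM u v : free_ext f (u * v) = free_ext f u * free_ext f v.
Proof.
rewrite -(word_class_repr u) -(word_class_repr v).
have -> : word_class (repr u) * word_class (repr v)
          = word_class (repr u ++ repr v) by exact: free_mulE.
by rewrite !free_extE word_eval_cat.
Qed.

HB.instance Definition _ :=
  isMultiplicative.Build free_group G (free_ext f) free_extM.

Lemma free_ext_uniq (h : {multiplicative free_group -> G}) :
  (forall x, h (free_gen x) = f x) -> h =1 free_ext f.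
Proof.
move=> hf u; have h1 : h 1 = 1.
  by apply: (@mulgI _ (h 1)); rewrite -gmulfM !mulg1.
rewrite -(word_class_repr u) free_extE.
elim: (repr u) => [|[b x] w IH]; first by rewrite /word_eval big_nil.
have -> : word_class ((b, x) :: w) = word_class [:: (b, x)] * word_class w.
  by symmetry; exact: free_mulE.
rewrite gmulfM IH /word_eval big_cons /=; congr (_ * _).
case: b => /=; last exact: hf.
apply: (@mulgI _ (h (free_gen x))); rewrite -gmulfM hf mulgV -h1; congr (h _).
have -> : word_class [:: (true, x)] = (free_gen x)^-1.
  by symmetry; exact: free_invE.
exact: mulgV.
Qed.

End Extension.
End FreeGroup.

Section ConjugatePreimage.
Variables (G : groupType) (H : groupClosed G) (y : G).

Definition conj_preim_pred : {pred G} := fun x => x ^ y \in H.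

Lemma conj_preim_group1 : 1 \in conj_preim_pred.
Proof. by rewrite unfold_in /conj_preim_pred conj1g gpred1. Qed.

Lemma conj_preim_groupM :
  {in conj_preim_pred &, forall u v, u * v \in conj_preim_pred}.
Proof.
move=> u v uH vH; rewrite unfold_in /conj_preim_pred conjMg.
exact: (gpredM _ _ uH vH).
Qed.

Lemma conj_preim_groupV :
  {in conj_preim_pred, forall u, u^-1 \in conj_preim_pred}.
Proof.
move=> u uH; rewrite unfold_in /conj_preim_pred conjVg.
exact: (gpredVr _ uH).
Qed.

HB.instance Definition _ :=
  isMulClosed.Build G conj_preim_pred conj_preim_groupM.
HB.instance Definition _ :=
  isMul1Closed.Build G conj_preim_pred conj_preim_group1.
HB.instance Definition _ :=
  isInvClosed.Build G conj_preim_pred conj_preim_groupV.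

Definition conj_preim : groupClosed G := conj_preim_pred.

End ConjugatePreimage.

Lemma normal_closure_normal (G : groupType) (S : set G) :
  is_normal (normal_closure S).
Proof.
move=> x y /generated_predP xS; apply/generated_predP => H SH.
apply: (xS (conj_preim H y)) => _ [s [z [Ss ->]]].
by apply: SH; exists s, (z * y); rewrite conjgM.
Qed.

Arguments normal_closure_normal {G} S.

Section Presentation.
Variables (T : choiceType) (R : set (free_group T)).

Definition presented_group : groupType :=
  quotient_group (normal_closure_normal R).

Definition presented_map : free_group T -> presented_group :=
  quotient_map (normal_closure_normal R).

End Presentation.

Definition isomorphic (G H : groupType) : Prop :=
  exists f : {multiplicative G -> H}, bijective f.

Definition composition_series (G : groupType) (m : nat)
    (N : nat -> groupClosed G) : Prop :=
  [/\ is_trivial (N 0), is_full (N m) &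
    forall k, (k < m)%N ->
      {subset N k <= N k.+1} /\
      exists nN : is_normal (restrict (N k.+1) (N k)),
        is_simple (quotient_group nN)].

Definition Phi (n : nat) : free_group 'I_n -> free_group 'I_n :=
  free_ext (fun i => free_gen i * free_gen (ordS i)).

Arguments Phi : clear implicits.

Definition Phi_gens (n a : nat) : set (free_group 'I_n) :=
  [set iter a (Phi n) (free_gen i) | i in [set: 'I_n]].

Arguments Phi_gens : clear implicits.

Definition Ghat (n a : nat) : groupType := presented_group (Phi_gens n a).

Definition Nsub (n a k : nat) : groupClosed (Ghat n a) :=
  generated (presented_map (Phi_gens n a) @` Phi_gens n (a - k)).

(* Main.v *)
Require Import Defs.
From HB Require Import structures.
From mathcomp Require Import all_boot zmodp.
From mathcomp Require Import boolp classical_sets cardinality.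

Local Open Scope card_scope.
Local Open Scope classical_set_scope.
Local Open Scope group_scope.

(** In [Ghat n a] write [y_(j,i)] for the image of [Phi^j(x_i)], so that
    [y_(j,i) y_(j,i+1) = y_(j+1,i)].  By descending induction on [j], [y_(j,i)]
    does not depend on [i] and is 2-torsion: if [w_i w_(i+1) = z] for all [i],
    then [w_(i+2) = w_i ^ z], so going twice around the cycle shows that [z ^ n]
    commutes with every [w_i]; as [n] is odd and [z] is 2-torsion, so does [z],
    hence [w_(i+2) = w_i], and [w] is constant because [n] is odd.  At [j = 0]
    all the [x_i] have the same image [g], so [Ghat n a] is generated by [g] with
    [g ^ (2 ^ a) = 1]; sending every [x_i] to [1] in [Z / 2 ^ a] shows that the
    order of [g] is exactly [2 ^ a].  Moreover [Nsub n a k] is generated by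
    [g ^ (2 ^ (a - k))]. *)

(** * Cyclic groups with a chosen generator *)

(** For [m > 0] this means cyclic of order [m] with generator [g]: natural exponents suffice because
    inverses are then powers. Orders, subgroups, quotients and isomorphisms all reduce to
    divisibility of exponents. *)
Definition cyclic_gen {G : groupType} (g : G) (m : nat) : Prop :=
  (forall x, exists k, x = g ^+ k) /\ (forall k, g ^+ k = 1 <-> m %| k).

Lemma subgroup_valX {G : groupType} {N : groupClosed G} {x} (xN : x \in N) k :
  val (SubgroupElt xN ^+ k) = x ^+ k.
Proof. by elim: k => [|k IH] //; rewrite !expgS -IH. Qed.

Section CyclicGen.
Context {G : groupType} {g : G} {m : nat} (gm : cyclic_gen g m).

Lemma cyclic_gen_expgP i j : g ^+ i = g ^+ j <-> i = j %[mod m].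
Proof.
wlog leij : i j / (i <= j)%N => [hw|].
  by case: (leqP i j) => [/hw//|/ltnW/hw [h1 h2]]; split=> /esym => [/h1|/h2].
rewrite -{1}(subnKC leij) expgnDr; split.
  rewrite -{1}[g ^+ i]mulg1 => /mulgI/esym /(gm.2 _) dv.
  by apply/esym/eqP; rewrite eqn_mod_dvd.
by move=> /esym/eqP; rewrite eqn_mod_dvd // => /(gm.2 _) ->; rewrite mulg1.
Qed.

Lemma cyclic_gen_commute (x y : G) : commute x y.
Proof.
have [[i ->] [j ->]] := (gm.1 x, gm.1 y).
exact/commuteX2/commute_refl.
Qed.

Lemma cyclic_gen_is_normal (H : groupClosed G) : is_normal H.
Proof. by move=> x y xH; rewrite conjgE cyclic_gen_commute mulgK. Qed.

Lemma cyclic_gen_is_cyclic : is_cyclic G.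
Proof.
exists g => x; have [k ->] := gm.1 x.
by apply/generated_predP => H gH; apply/gpredXn/gH.
Qed.

Lemma cyclic_gen_card : (0 < m)%N -> [set: G] #= `I_m.
Proof.
move=> m_gt0; have -> : [set: G] = (fun k => g ^+ k) @` `I_m.
  rewrite eqEsubset; split=> // x _; have [k ->] := gm.1 x.
  exists (k %% m)%N; first exact: ltn_pmod.
  by apply/cyclic_gen_expgP; rewrite modn_mod.
apply: inj_card_eq => i j; rewrite !inE /= => im jm /cyclic_gen_expgP.
by rewrite !modn_small.
Qed.

(** The powers [g ^+ (d * j)] form a subgroup, with exponent [d * j * m.-1] giving the inverse. As
    [d] divides [m], congruence of exponents modulo [m] preserves divisibility by [d]. *)
Lemma mem_generated_expg (d : nat) (S : set G) i :
  (0 < m)%N -> d %| m -> S = [set g ^+ d] ->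
  g ^+ i \in generated S <-> d %| i.
Proof.
move=> m_gt0 dm ->; split; last first.
  move=> /dvdnP[j ->]; apply/generated_predP => H gH.
  by rewrite mulnC expgnA; apply/gpredXn/gH.
pose P : {pred G} := fun x => `[< exists j, x = g ^+ (d * j) >].
have P1 : 1 \in P by apply/asboolP; exists 0; rewrite muln0.
have PM : {in P &, forall x y, x * y \in P}.
  move=> _ _ /asboolP[j ->] /asboolP[k ->].
  by apply/asboolP; exists (j + k)%N; rewrite mulnDr expgnDr.
have PV : {in P, forall x, x^-1 \in P}.
  move=> _ /asboolP[j ->]; apply/asboolP; exists (j * m.-1)%N.
  apply: (mulgI (g ^+ (d * j))); rewrite mulgV -expgnDr.
  symmetry; apply/(gm.2 _); rewrite mulnA -mulnS prednK //.
  exact: dvdn_mull.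
pose H : groupClosed G := HB.pack P (isMulClosed.Build G P PM)
  (isMul1Closed.Build G P P1) (isInvClosed.Build G P PV).
move=> /generated_predP /(_ H) gi.
have /asboolP[j /cyclic_gen_expgP/eqP] : g ^+ i \in P.
  by apply: gi => _ ->; apply/asboolP; exists 1%N; rewrite muln1.
move=> /eqP /(congr1 (modn^~ d)); rewrite !modn_dvdm // modnMr.
by move=> /eqP.
Qed.

Lemma cyclic_gen_subgroup (N : groupClosed G) d m' (dN : g ^+ d \in N) :
  (0 < d)%N -> m = (d * m')%N -> (forall i, g ^+ i \in N <-> d %| i) ->
  cyclic_gen (SubgroupElt dN) m'.
Proof.
move=> d_gt0 mE gN.
have valX k : val (SubgroupElt dN ^+ k) = g ^+ (d * k).
  by rewrite subgroup_valX expgnA.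
split=> [x|k].
  have [i xi] := gm.1 (val x).
  have /gN/dvdnP[k ik] : g ^+ i \in N by rewrite -xi; exact: subgroup_valP.
  by exists k; apply/val_inj; rewrite valX xi ik mulnC.
rewrite -(dvdn_pmul2l d_gt0) -mE; split.
  by move=> /(congr1 val); rewrite valX => /(gm.2 _).
by move=> /(gm.2 _) gk; apply/val_inj; rewrite valX.
Qed.

End CyclicGen.

(** * Quotients and isomorphisms of cyclic groups *)

Lemma quotient_mapM {G : groupType} {N : groupClosed G} (nN : is_normal N)
    x y :
  quotient_map nN (x * y) = quotient_map nN x * quotient_map nN y.
Proof. by symmetry; exact: quotient_mulE. Qed.

HB.instance Definition _ (G : groupType) (N : groupClosed G)
    (nN : is_normal N) :=
  isMultiplicative.Build G (quotient_group nN) (quotient_map nN)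
    (quotient_mapM nN).

Lemma quotient_map_eq1 {G : groupType} {N : groupClosed G} (nN : is_normal N)
    x :
  quotient_map nN x = 1 <-> x \in N.
Proof.
split; last by move=> xN; apply/esym/quotient_mapP; rewrite invg1 mul1g.
by move=> /esym/quotient_mapP; rewrite invg1 mul1g.
Qed.

Lemma quotient_mapX {G : groupType} {N : groupClosed G} (nN : is_normal N)
    x k :
  quotient_map nN (x ^+ k) = quotient_map nN x ^+ k.
Proof.
by elim: k => [|k IH]; rewrite ?expgS ?quotient_mapM ?IH.
Qed.

Lemma cyclic_gen_quotient {G : groupType} {N : groupClosed G}
    (nN : is_normal N) (g : G) m :
  (forall x, exists k, x = g ^+ k) -> (forall k, g ^+ k \in N <-> m %| k) ->
  cyclic_gen (quotient_map nN g) m.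
Proof.
move=> genG gN; split=> [u|k]; last first.
  by rewrite -quotient_mapX; apply: iff_trans (gN k); exact: quotient_map_eq1.
have [k uk] := genG (generic_quotient.repr u).
by exists k; rewrite -quotient_mapX -uk quotient_reprK.
Qed.

Lemma cyclic_gen_isomorphic {G H : groupType} {g : G} {h : H} {m} :
  cyclic_gen g m -> cyclic_gen h m -> isomorphic G H.
Proof.
move=> gm hm.
(* Chosen discrete logarithms are determined only modulo [m], which is enough since powers of [g]
   and [h] depend only on the exponent modulo [m]. *)
have [logg loggP] := choice gm.1; have [logh loghP] := choice hm.1.
pose f x := h ^+ logg x.
have fM : {morph f : x y / x * y}.
  move=> x y; rewrite /f -expgnDr.
  apply/(cyclic_gen_expgP hm)/(cyclic_gen_expgP gm).
  by rewrite expgnDr -!loggP.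
pose F : {multiplicative G -> H} := HB.pack f (isMultiplicative.Build G H f fM).
exists F; exists (fun y => g ^+ logh y) => [x|y] /=.
  rewrite [RHS](loggP x); apply/(cyclic_gen_expgP gm)/(cyclic_gen_expgP hm).
  by rewrite -loghP.
rewrite [RHS](loghP y); apply/(cyclic_gen_expgP hm)/(cyclic_gen_expgP gm).
by rewrite -loggP.
Qed.

(** The group law is addition, so powers are multiples. This serves both as the model of ['Z_2] and
    as the target that bounds the order of [Ghat n a] from below. *)
Lemma cyclic_gen_Zp p : cyclic_gen (Zp1 : 'I_p.+1) p.+1.
Proof.
split=> [x|k]; first by exists x; rewrite Zp1_expgz.
rewrite Zp_expg; split.
  by move=> /(congr1 val) /=; rewrite modnMml mul1n => /eqP.
by move=> /eqP k0; apply/val_inj; rewrite /= modnMml mul1n.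
Qed.

Lemma cyclic_gen2_is_simple {G : groupType} {g : G} :
  cyclic_gen g 2 -> is_simple G.
Proof.
move=> g2; split; first by exists g; rewrite -[g]expg1 => /(g2.2 _).
move=> H _; case gH: (g \in H); [right|left] => x; have [k ->] := g2.1 x.
  exact: gpredXn.
split=> [|->]; last exact: gpred1.
have -> : g ^+ k = g ^+ (odd k).
  by apply/(cyclic_gen_expgP g2); rewrite !modn2; case: odd.
by case: (odd k) => //=; rewrite expg1 gH.
Qed.

(** * Cyclically indexed families with constant consecutive products *)

Lemma val_iter_ordS n (i : 'I_n) k : iter k (@ordS n) i = (i + k) %% n :> nat.
Proof.
elim: k => [|k IH] /=; first by rewrite addn0 modn_small.
by rewrite IH -addn1 modnDml addn1 addnS.
Qed.

Lemma ordS_invariant_const n T (w : 'I_n -> T) :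
  (forall i, w (ordS i) = w i) -> forall i j, w i = w j.
Proof.
move=> wS i j; have witer k : w (iter k (@ordS n) i) = w i.
  by elim: k => //= k <-.
(* [j + (n - i)] represents [j - i] modulo [n] without truncated subtraction. *)
rewrite -(witer (j + (n - i))%N); congr w; apply/val_inj => /=.
by rewrite val_iter_ordS addnCA subnKC 1?ltnW // modnDr modn_small.
Qed.

Lemma cyclic_products_const n m (G : groupType) (w : 'I_n -> G) (z : G) :
  odd n -> coprime n m -> z ^+ m = 1 ->
  (forall i, w i * w (ordS i) = z) -> forall i j, w i = w j.
Proof.
move=> n_odd nm zm wz.
have wS i : w (ordS i) = (w i)^-1 * z by rewrite -(wz i) mulKg.
have wSS i : w (ordS (ordS i)) = w i ^ z.
  by rewrite !wS invgM invgK conjgE mulgA.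
have witer k i : w (iter k.*2 (@ordS n) i) = w i ^ (z ^+ k).
  elim: k => [|k IH]; first by rewrite conjg1.
  by rewrite doubleS !iterS wSS IH expgSr conjgM.
have cwz i : commute (w i) z.
  have cn : commute (w i) (z ^+ n).
    apply/commgP/conjg_fixP; rewrite -witer; congr w; apply/val_inj.
    by rewrite /= val_iter_ordS -addnn addnA !modnDr modn_small.
  (* Bezout gives [r * n = s * m + 1], so [z] is the [r]-th power of [z ^+ n]. *)
  case: (egcdnP m (odd_gt0 n_odd)) => r s rn _.
  have <- : z ^+ n ^+ r = z.
    by rewrite -expgnA mulnC rn (eqP nm) expgnDr mulnC expgnA zm expg1n mul1g.
  exact: commuteX.
apply: ordS_invariant_const => i.
(* One step equals [n + 1] steps around the cycle, an even number because [n] is odd, so [witer]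
   applies. *)
have -> : ordS i = iter n.+1./2.*2 (@ordS n) i.
  rewrite even_halfK /= ?n_odd //; apply/val_inj.
  by rewrite /= val_iter_ordS modnDr (modn_small (ltn_ord i)).
rewrite witer; apply/conjg_fixP/commgP.
exact: commuteX.
Qed.

(** * The groups [Ghat n a] *)

(** The kernel of [f] is a subgroup containing every conjugate of an element of [S]. *)
Lemma normal_closure_ker {G H : groupType} (f : {multiplicative G -> H})
    (S : set G) x :
  (forall s, S s -> f s = 1) -> x \in normal_closure S -> f x = 1.
Proof.
move=> fS; have f1 : f 1 = 1.
  by apply: (mulgI (f 1)); rewrite -gmulfM !mulg1.
have fV y : f y^-1 = (f y)^-1.
  by apply: (mulgI (f y)); rewrite -gmulfM !mulgV.
pose P : {pred G} := fun y => f y == 1.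
have P1 : 1 \in P by apply/eqP.
have PM : {in P &, forall y z, y * z \in P}.
  by move=> y z /eqP fy /eqP fz; apply/eqP; rewrite gmulfM fy fz mulg1.
have PV : {in P, forall y, y^-1 \in P}.
  by move=> y /eqP fy; apply/eqP; rewrite fV fy invg1.
pose K : groupClosed G := HB.pack P (isMulClosed.Build G P PM)
  (isMul1Closed.Build G P P1) (isInvClosed.Build G P PV).
move=> /generated_predP /(_ K) xK; apply/eqP/xK => _ [s [y [Ss ->]]].
by apply/eqP; rewrite conjgE !gmulfM fV (fS s Ss) mul1g mulVg.
Qed.

HB.instance Definition _ (T : choiceType) (R : set (free_group T)) :=
  Multiplicative.copy (presented_map R)
    (quotient_map (normal_closure_normal R)).

HB.instance Definition _ (n : nat) :=
  Multiplicative.copy (Phi n)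
    (free_ext (fun i : 'I_n => free_gen i * free_gen (ordS i))).

Lemma iter_PhiM n j u v :
  iter j (Phi n) (u * v) = iter j (Phi n) u * iter j (Phi n) v.
Proof. by elim: j => //= j ->; exact: gmulfM. Qed.

Lemma iter_Phi_gen n j (i : 'I_n) :
  iter j.+1 (Phi n) (free_gen i) =
  iter j (Phi n) (free_gen i) * iter j (Phi n) (free_gen (ordS i)).
Proof. by rewrite iterSr -iter_PhiM /Phi free_ext_gen. Qed.

Lemma iter_Phi_gen_const {n} {G : groupType}
    (f : {multiplicative free_group 'I_n -> G}) (t : G) :
  (forall i, f (free_gen i) = t) ->
  forall j i, f (iter j (Phi n) (free_gen i)) = t ^+ (2 ^ j).
Proof.
move=> ft; elim=> [|j IH] i; first by rewrite /= ft.
by rewrite iter_Phi_gen gmulfM !IH -expgnDr addnn -mul2n expnS.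
Qed.

Lemma iter_Phi_gen_eq {n a} {G : groupType}
    (f : {multiplicative free_group 'I_n -> G}) :
  odd n -> (forall i, f (iter a (Phi n) (free_gen i)) = 1) ->
  forall i j, f (free_gen i) = f (free_gen j).
Proof.
move=> n_odd fa.
(* The induction ascends on [e], the distance of the level from [a]. The torsion bound [2 ^ e] is
   carried along because it supplies the exponent coprime to [n] at the next level. *)
suff h e : (e <= a)%N -> forall i j,
    f (iter (a - e) (Phi n) (free_gen i))
      = f (iter (a - e) (Phi n) (free_gen j)) /\
    f (iter (a - e) (Phi n) (free_gen i)) ^+ (2 ^ e) = 1.
  by move=> i j; have [] := h a (leqnn a) i j; rewrite subnn.
elim: e => [|e IH] ea i j; first by rewrite subn0 !fa expg1n.
have aE : (a - e = (a - e.+1).+1)%N by rewrite subnSK.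
set w := fun i => f (iter (a - e.+1) (Phi n) (free_gen i)).
have wE k : w k * w (ordS k) = f (iter (a - e) (Phi n) (free_gen k)).
  by rewrite aE iter_Phi_gen gmulfM.
have wC : forall k l, w k = w l.
  apply: (@cyclic_products_const n (2 ^ e) _ w (w i * w (ordS i))) => //.
  - by rewrite coprimeXr // coprimen2.
  - by rewrite wE; exact: (IH (ltnW ea) i i).2.
  - by move=> k; rewrite !wE; exact: (IH (ltnW ea) k i).1.
split; first exact: wC.
(* By constancy the square of [w i] is [w i * w (ordS i)], an element one level up that is killed by
   [2 ^ e]. *)
rewrite expnS expgnA expg2 -/(w i) {2}(wC i (ordS i)) wE.
exact: (IH (ltnW ea) i i).2.
Qed.

Lemma presented_map_rel {T : choiceType} (R : set (free_group T)) u :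
  R u -> presented_map R u = 1.
Proof.
move=> Ru; apply/quotient_map_eq1/generated_predP => H SH.
by apply: SH; exists u, 1; rewrite conjg1.
Qed.

Section GhatCyclic.
Context {n : nat} (n_odd : odd n).

Definition Ghat_gen a : Ghat n a :=
  presented_map (Phi_gens n a) (free_gen (Ordinal (odd_gt0 n_odd))).

Lemma presented_map_free_gen a i :
  presented_map (Phi_gens n a) (free_gen i) = Ghat_gen a.
Proof.
apply: (@iter_Phi_gen_eq n a) => // k.
by apply: presented_map_rel; exists k.
Qed.

Lemma presented_map_iter_Phi a j i :
  presented_map (Phi_gens n a) (iter j (Phi n) (free_gen i)) =
  Ghat_gen a ^+ (2 ^ j).
Proof. exact/iter_Phi_gen_const/presented_map_free_gen. Qed.

Lemma Ghat_gen_torsion a : Ghat_gen a ^+ (2 ^ a) = 1.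
Proof.
rewrite -(presented_map_iter_Phi a a (Ordinal (odd_gt0 n_odd))).
by apply: presented_map_rel; exists (Ordinal (odd_gt0 n_odd)).
Qed.

Lemma Ghat_gen_generates a (x : Ghat n a) : exists k, x = Ghat_gen a ^+ k.
Proof.
(* Letters [x^-1] of a word must also contribute natural powers of the generator. *)
have gV : (Ghat_gen a)^-1 = Ghat_gen a ^+ (2 ^ a).-1.
  apply: (mulgI (Ghat_gen a)).
  by rewrite mulgV -expgS prednK ?expn_gt0 // Ghat_gen_torsion.
have -> : x = presented_map (Phi_gens n a) (generic_quotient.repr x).
  by symmetry; exact: quotient_reprK.
rewrite (free_ext_uniq (f := fun=> Ghat_gen a)) /free_ext; last first.
  exact: presented_map_free_gen.
elim: (generic_quotient.repr _) => [|[b i] u [k IH]].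
  by exists 0; rewrite /word_eval big_nil.
rewrite -cat1s word_eval_cat IH {1}/word_eval big_seq1 /=.
case: b; last by exists k.+1; rewrite expgS.
by exists ((2 ^ a).-1 + k)%N; rewrite gV expgnDr.
Qed.

Lemma Ghat_cyclic_gen a : cyclic_gen (Ghat_gen a) (2 ^ a).
Proof.
split=> [|k]; first exact: Ghat_gen_generates.
split=> [gk|/dvdnP[r ->]]; last first.
  by rewrite mulnC expgnA Ghat_gen_torsion expg1n.
have aE : (2 ^ a = (2 ^ a).-1.+1)%N by rewrite prednK ?expn_gt0.
pose t : 'I_(2 ^ a).-1.+1 := Zp1.
have tk j : t ^+ j = 1 <-> 2 ^ a %| j.
  by rewrite [in X in _ <-> X]aE; exact: (cyclic_gen_Zp _).2.
have x0E : presented_map (Phi_gens n a)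
    (free_gen (Ordinal (odd_gt0 n_odd)) ^+ k) = 1.
  by rewrite -gk; exact: quotient_mapX.
(* The homomorphism sending every [x_i] to [t] maps [x_0 ^+ k] to [t ^+ k]. It sends each relator to
   [t ^+ (2 ^ a) = 1], so it is trivial on the normal closure, where [x_0 ^+ k] lies. *)
apply/tk; have <- : free_ext (fun _ : 'I_n => t)
    (free_gen (Ordinal (odd_gt0 n_odd)) ^+ k) = t ^+ k.
  elim: k {gk x0E} => [|k IH]; last by rewrite !expgS free_extM IH free_ext_gen.
  by apply: etrans (free_extE _ [::]) _; rewrite /word_eval big_nil.
apply: (normal_closure_ker _ (Phi_gens n a));
  last by move: x0E => /quotient_map_eq1.
move=> _ [i _ <-]; rewrite (iter_Phi_gen_const _ t); first exact/tk.
by move=> l; rewrite /= free_ext_gen.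
Qed.

Lemma mem_Nsub a k i : Ghat_gen a ^+ i \in Nsub n a k <-> 2 ^ (a - k) %| i.
Proof.
apply: (mem_generated_expg (Ghat_cyclic_gen a)).
- by rewrite expn_gt0.
- exact/dvdn_exp2l/leq_subr.
(* All [n] generators of [Nsub n a k] coincide in [Ghat n a]. *)
rewrite eqEsubset; split=> [_ [_ [l _ <-] <-]|_ ->] /=.
  exact: presented_map_iter_Phi.
rewrite -(presented_map_iter_Phi _ _ (Ordinal (odd_gt0 n_odd))).
eexists; last reflexivity.
by exists (Ordinal (odd_gt0 n_odd)).
Qed.

Lemma Nsub_gen a k : Ghat_gen a ^+ (2 ^ (a - k)) \in Nsub n a k.
Proof. exact/mem_Nsub. Qed.

Lemma Nsub_cyclic_gen {a k} :
  (k <= a)%N -> cyclic_gen (SubgroupElt (Nsub_gen a k)) (2 ^ k).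
Proof.
move=> ka; apply: (cyclic_gen_subgroup (Ghat_cyclic_gen a)).
- by rewrite expn_gt0.
- by rewrite -expnD subnK.
- exact: mem_Nsub.
Qed.

(** The [i]-th power of the generator of the larger subgroup lies in the smaller one iff
    [2 ^ (a - k)] divides [2 ^ (a - k.+1) * i], that is, iff [i] is even. *)
Lemma Nsub_quotient_cyclic_gen {a k}
    (nN : is_normal (restrict (Nsub n a k.+1) (Nsub n a k))) :
  (k < a)%N -> cyclic_gen (quotient_map nN (SubgroupElt (Nsub_gen a k.+1))) 2.
Proof.
move=> ka; have gN := Nsub_cyclic_gen ka.
apply: cyclic_gen_quotient => [|i]; first exact: gN.1.
have -> : (SubgroupElt (Nsub_gen a k.+1) ^+ i \in
    restrict (Nsub n a k.+1) (Nsub n a k)) =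
    (Ghat_gen a ^+ (2 ^ (a - k.+1) * i) \in Nsub n a k).
  by rewrite expgnA -(subgroup_valX (Nsub_gen a k.+1)).
apply: iff_trans (mem_Nsub a k _) _.
by rewrite -(subnSK ka) expnSr dvdn_pmul2l ?expn_gt0.
Qed.

End GhatCyclic.

(* 'Z_2 carries its additive group law, the canonical groupType structure
   of 'Z_2. *)
Theorem lemma3p13 (n : nat) (n_odd : odd n) (a : nat) (a_gt0 : (0 < a)%N) :
  [/\ is_cyclic (Ghat n a),
      [set: Ghat n a] #= `I_(2 ^ a)%N,
      forall k : nat, (k <= a)%N ->
        is_normal (Nsub n a k) /\
        isomorphic (subgroup_type (Nsub n a k)) (Ghat n k),
      composition_series a (Nsub n a) &
      forall k : nat, (0 < k <= a)%N ->
        exists nN : is_normal (restrict (Nsub n a k) (Nsub n a k.-1)),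
          isomorphic (quotient_group nN) 'Z_2].
Proof.
have gG := Ghat_cyclic_gen n_odd.
have nN k : (k < a)%N -> is_normal (restrict (Nsub n a k.+1) (Nsub n a k)).
  by move=> ka; exact: cyclic_gen_is_normal (Nsub_cyclic_gen n_odd ka) _.
split.
- exact: cyclic_gen_is_cyclic (gG a).
- by apply: cyclic_gen_card (gG a) _; rewrite expn_gt0.
- move=> k ka; split; first exact: cyclic_gen_is_normal (gG a) _.
  exact: cyclic_gen_isomorphic (Nsub_cyclic_gen n_odd ka) (gG k).
- split=> [x|x|k ka].
  + split=> [|->]; last exact: gpred1.
    have [i ->] := (gG a).1 x.
    by move=> /mem_Nsub; rewrite subn0 => /(gG a).2.
  + have [i ->] := (gG a).1 x.
    by apply/mem_Nsub; rewrite subnn dvd1n.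
  + split; last first.
      by exists (nN k ka);
        exact: cyclic_gen2_is_simple (Nsub_quotient_cyclic_gen n_odd _ ka).
    move=> x; have [i ->] := (gG a).1 x => /mem_Nsub ki; apply/mem_Nsub.
    by apply: dvdn_trans ki; apply/dvdn_exp2l/leq_sub2l.
(* The case [k = 0] is excluded by the range; for a successor, the predecessor reduces and the
   previous normality fact applies. *)
- case=> // k ka; exists (nN k ka).
  exact: cyclic_gen_isomorphic (Nsub_quotient_cyclic_gen n_odd _ ka)
    (cyclic_gen_Zp 1).
Qed.
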